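(* Let $F=\frac1n\sum_{i=1}^nF_i$ be $\mu$-quasi-strongly monotone with $\mu>0$. Assume that there is $\widehat\ell>0$ such that for all $x\in\mathbb{R}^d$, with $x^*=\mathrm{proj}_{X^*}(x)$, $$\frac1n\sum_{i=1}^n\|F_i(x)-F_i(x^* )\|^2\le\widehat\ell\,\langle F(x)-F(x^* ),x-x^*\rangle,$$ that $X^*=\{x^*\}$ is a singleton, and that $0<\gamma\le\frac1{6\widehat\ell}$. Then for all $k\ge0$ the iterates produced by SAGA-SGDA satisfy $$\mathbb{E}\|x^k-x^*\|^2\le\left(1-\min\left\{\gamma\mu,\frac1{2n}\right\}\right)^kV_0,\qquad V_0=\|x^0-x^*\|^2+4n\gamma^2\sigma_0^2,$$ where $\sigma_0^2=\frac1n\sum_{i=1}^n\|F_i(w_i^0)-F_i(x^* )\|^2$.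
   Context: Norms and inner products on $\mathbb{R}^d$ are Euclidean. $F,F_1,\dots,F_n:\mathbb{R}^d\to\mathbb{R}^d$ are operators and $R:\mathbb{R}^d\to\mathbb{R}\cup\{+\infty\}$ is a proper lower semicontinuous convex function. $X^*$ is the (nonempty) set of solutions of the regularized variational inequality: find $x^*\in\mathbb{R}^d$ with $\langle F(x^* ),x-x^*\rangle+R(x)-R(x^* )\ge0$ for all $x\in\mathbb{R}^d$. $\mathrm{proj}_{X^*}(x)=\arg\min_{y\in X^*}\|y-x\|$. $F$ is $\mu$-quasi-strongly monotone if $\langle F(x)-F(x^* ),x-x^*\rangle\ge\mu\|x-x^*\|^2$ for all $x\in\mathbb{R}^d$, where $x^*=\mathrm{proj}_{X^*}(x)$. SAGA-SGDA, with deterministic $x^0\in\mathbb{R}^d$ and $w_i^0=x^0$ for all $i$: at each iteration $k\ge0$ draw $j_k$ uniformly from $\{1,\dots,n\}$ (independently of the past), set $g^k=F_{j_k}(x^k)-F_{j_k}(w_{j_k}^k)+\frac1n\sum_{i=1}^nF_i(w_i^k)$, $w_{j_k}^{k+1}=x^k$, $w_i^{k+1}=w_i^k$ for $i\ne j_k$, and $x^{k+1}=\mathrm{prox}_{\gamma R}(x^k-\gamma g^k)$, where $\mathrm{prox}_{\gamma R}(x)=\arg\min_{y}\{R(y)+\|y-x\|^2/(2\gamma)\}$. *)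

(* Defs.v *)
From mathcomp Require Import all_boot all_order all_algebra.
From mathcomp Require Import all_classical all_reals all_analysis.

Set Implicit Arguments.
Unset Strict Implicit.
Unset Printing Implicit Defensive.

Import Order.TTheory GRing.Theory Num.Theory.
Import numFieldNormedType.Exports.

Local Open Scope classical_set_scope.
Local Open Scope ring_scope.

Section Euclidean.
Context {R : realType} {d : nat}.
Implicit Types u v : 'rV[R]_d.

Definition dot u v : R := \sum_(i < d) u 0 i * v 0 i.

(* The library norm on ['rV[R]_d] is the sup norm, hence this one. *)
Definition enorm u : R := Num.sqrt (dot u u).

End Euclidean.

Section Convex.
Context {R : realType} {d : nat}.
Implicit Types (r : 'rV[R]_d -> \bar R) (x y : 'rV[R]_d).

Definition eproper r : Prop :=
  (forall x, (-oo < r x)%E) /\ (exists x, (r x < +oo)%E).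

(* [convex_function] of the library only covers real-valued functions.  The
   convention [0 * +oo = 0] makes the endpoints t = 0, 1 harmless. *)
Definition econvex r : Prop :=
  forall x y (t : R), 0 <= t <= 1 ->
    (r (t *: x + (1 - t) *: y)%R <= t%:E * r x + (1 - t)%:E * r y)%E.

Definition argmins (S : set 'rV[R]_d) (f : 'rV[R]_d -> \bar R) :
    set 'rV[R]_d :=
  [set y | S y /\ forall z, S z -> (f y <= f z)%E].

(* A minimizer of [f] on [S]; the default value 0 is returned only when there
   is none. *)
Definition argmin (S : set 'rV[R]_d) (f : 'rV[R]_d -> \bar R) : 'rV[R]_d :=
  xget 0 (argmins S f).

Definition eproj (S : set 'rV[R]_d) x : 'rV[R]_d :=
  argmin S (fun y => (enorm (y - x))%:E).

Definition prox (gamma : R) r x : 'rV[R]_d :=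
  argmin setT (fun y => (r y + (enorm (y - x)%R ^+ 2 / (2 * gamma))%:E)%E).

(* Since [+oo - +oo = -oo] in [\bar R], a solution of the inequality is
   automatically in the domain of an [eproper] [r]. *)
Definition VI_sol (F : 'rV[R]_d -> 'rV[R]_d) r : set 'rV[R]_d :=
  [set xs | forall x, (0 <= (dot (F xs) (x - xs)%R)%:E + (r x - r xs))%E].

Definition quasi_strongly_monotone (F : 'rV[R]_d -> 'rV[R]_d) r (mu : R) :
    Prop :=
  forall x, let xs := eproj (VI_sol F r) x in
    dot (F x - F xs) (x - xs) >= mu * enorm (x - xs) ^+ 2.

End Convex.

Section Saga.
Context {R : realType} {d n : nat}.
Variable Fs : 'I_n -> 'rV[R]_d -> 'rV[R]_d.

Definition mean_op (x : 'rV[R]_d) : 'rV[R]_d :=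
  n%:R^-1 *: \sum_(i < n) Fs i x.

(* A state is the pair of the iterate x^k and the table (w_i^k)_i. *)
Definition saga_state : Type := ('rV[R]_d * ('I_n -> 'rV[R]_d))%type.

Definition saga_init (x0 : 'rV[R]_d) : saga_state := (x0, fun=> x0).

Definition saga_dir (s : saga_state) (j : 'I_n) : 'rV[R]_d :=
  Fs j s.1 - Fs j (s.2 j) + n%:R^-1 *: \sum_(i < n) Fs i (s.2 i).

Definition saga_step (gamma : R) (r : 'rV[R]_d -> \bar R)
    (s : saga_state) (j : 'I_n) : saga_state :=
  (prox gamma r (s.1 - gamma *: saga_dir s j),
   fun i => if i == j then s.1 else s.2 i).

Fixpoint saga (gamma : R) (r : 'rV[R]_d -> \bar R) (x0 : 'rV[R]_d)
    (j : nat -> 'I_n) (k : nat) : saga_state :=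
  if k is k'.+1 then saga_step gamma r (saga gamma r x0 j k') (j k')
  else saga_init x0.

Definition sigma2 (w : 'I_n -> 'rV[R]_d) (xs : 'rV[R]_d) : R :=
  n%:R^-1 * \sum_(i < n) enorm (Fs i (w i) - Fs i xs) ^+ 2.

End Saga.

Section Sampling.
Context {disp : measure_display} {T : measurableType disp} {R : realType}.
Context (P : probability T R) {n : nat}.

(* ['I_n] carries the discrete sigma-algebra, i.e. all of its subsets. *)
Definition iid_uniform (j : nat -> T -> 'I_n) : Prop :=
  [/\ forall k (A : set 'I_n), measurable (j k @^-1` A),
      forall k (i : 'I_n), P (j k @^-1` [set i]) = (n%:R^-1)%:E
    & forall (s : seq nat) (A : nat -> set 'I_n), uniq s ->
        P (\bigcap_(k in [set` s]) (j k @^-1` A k))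
        = (\prod_(k <- s) P (j k @^-1` A k))%E].

End Sampling.

(* Main.v *)
Require Import Defs.
From mathcomp Require Import all_boot all_order all_algebra.
From mathcomp Require Import all_classical all_reals all_analysis.
From mathcomp Require Import measurable_realfun.
From mathcomp Require Import finmap.
From mathcomp Require Import ring lra.

Set Implicit Arguments.
Unset Strict Implicit.
Unset Printing Implicit Defensive.

Import Order.TTheory GRing.Theory Num.Theory.
Import numFieldNormedType.Exports.

Local Open Scope classical_set_scope.
Local Open Scope ring_scope.

(** The Lyapunov function [||x - x^*||^2 + 4 n gamma^2 sigma^2] contracts in
   mean over one uniform draw.  Since [x^*] solves the variational inequality,
   it is fixed by [y |-> prox (y - gamma F(y))], and the prox step does not
   increase distances to it: with [D = <F(x) - F(x^* ), x - x^*>], the mean of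
   [||x^+ - x^*||^2] is at most
   [||x - x^*||^2 - 2 gamma D + 2 gamma^2 (ell D + sigma^2)], while [sigma^2]
   becomes in mean at most [(1 - 1/n) sigma^2 + ell D / n].  For
   [gamma <= 1 / (6 ell)] the [D] terms add up to at most
   [- gamma D <= - gamma mu ||x - x^*||^2].  The state after k steps depends
   only on the first k draws, which are uniform on the k-tuples, so its
   expectation is a finite average and the contraction iterates. *)

(** * Continuity, the Euclidean inner product, and minima on compact sets *)

Lemma continuous_sumr (R : realType) (X : topologicalType) (I : Type)
    (s : seq I) (f : I -> X -> R) :
  (forall i, continuous (f i)) -> continuous (fun x => \sum_(i <- s) f i x).
Proof.
move=> f_cont; elim: s => [|i s IHs].
  rewrite (_ : (fun _ => _) = cst 0); first exact: cst_continuous.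
  by apply/funext => x; rewrite big_nil.
rewrite (_ : (fun _ => _) = f i \+ fun x => \sum_(l <- s) f l x).
  by move=> x; apply: cvgD; [exact: f_cont | exact: IHs].
by apply/funext => x; rewrite big_cons.
Qed.

Section DotTheory.
Context {R : realType} {d : nat}.
Implicit Types (u v w : 'rV[R]_d) (a : R).

Lemma dotC u v : dot u v = dot v u.
Proof. by apply: eq_bigr => i _; rewrite mulrC. Qed.

Lemma dotDl u v w : dot (u + v) w = dot u w + dot v w.
Proof.
by rewrite /dot -big_split; apply: eq_bigr => i _; rewrite mxE mulrDl.
Qed.

Lemma dotZl a u v : dot (a *: u) v = a * dot u v.
Proof. by rewrite /dot mulr_sumr; apply: eq_bigr => i _; rewrite mxE mulrA. Qed.

Lemma dotDr u v w : dot u (v + w) = dot u v + dot u w.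
Proof. by rewrite dotC dotDl !(dotC _ u). Qed.

Lemma dotZr a u v : dot u (a *: v) = a * dot u v.
Proof. by rewrite dotC dotZl dotC. Qed.

Lemma dotNl u v : dot (- u) v = - dot u v.
Proof. by rewrite -scaleN1r dotZl mulN1r. Qed.

Lemma dotNr u v : dot u (- v) = - dot u v.
Proof. by rewrite dotC dotNl dotC. Qed.

Lemma dot0l v : dot 0 v = 0.
Proof. by rewrite -(scale0r 0) dotZl mul0r. Qed.

Definition dotE := (dotDl, dotDr, dotNl, dotNr, dotZl, dotZr).

Lemma dot_suml n (f : 'I_n -> 'rV[R]_d) v :
  dot (\sum_(i < n) f i) v = \sum_(i < n) dot (f i) v.
Proof.
rewrite exchange_big /=; apply: eq_bigr => i _.
by rewrite summxE mulr_suml.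
Qed.

Lemma dot_ge0 u : 0 <= dot u u.
Proof. by apply: sumr_ge0 => i _; rewrite -expr2 sqr_ge0. Qed.

Lemma enorm_sqr u : enorm u ^+ 2 = dot u u.
Proof. by rewrite sqr_sqrtr// dot_ge0. Qed.

Lemma sqr_coord_le_dot u i : u 0 i ^+ 2 <= dot u u.
Proof.
rewrite /dot (bigD1 i)//= -expr2 lerDl; apply: sumr_ge0 => l _.
by rewrite -expr2 sqr_ge0.
Qed.

Lemma dot_sqr_continuous z :
  continuous (fun y : 'rV[R]_d => dot (y - z) (y - z)).
Proof.
apply: continuous_sumr => i x.
have ci : (y - z) 0 i @[y --> x] --> (x - z) 0 i.
  rewrite !mxE (_ : (fun y : 'rV[R]_d => (y - z) 0 i) = fun y => y 0 i - z 0 i).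
    exact: (cvgB (@coord_continuous R 1 d 0 i x) (cvg_cst _)).
  by apply/funext => y; rewrite !mxE.
exact: (cvgM ci ci).
Qed.

End DotTheory.

(** Without a minimum, the open sets where [f] exceeds [f z], for [z] in [A], cover [A]. A finite
    subcover has a centre with the smallest value of [f], and no set of the subcover contains that
    centre. *)
Lemma lsc_compact_min (R : realType) (X : ptopologicalType) (f : X -> \bar R)
    (A : set X) :
  lower_semicontinuous f -> (forall x, (-oo < f x)%E) -> compact A ->
  A !=set0 -> exists2 y, A y & forall x, A x -> (f y <= f x)%E.
Proof.
move=> f_lsc f_ninfty + [x0 Ax0]; rewrite compact_cover => cA.
apply: contrapT => nomin.
have below y : A y -> exists2 x, A x & (f x < f y)%E.
  move=> Ay; apply: contrapT => no; apply: nomin; exists y => // x Ax.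
  by rewrite leNgt; apply/negP => lt; apply: no; exists x.
have [||D DA cov] := cA X A (fun z => [set x | (f z < f x)%E]).
- move=> z _ /=; have := f_ninfty z; case: (f z) => [a _|_|//].
    exact: (lower_semicontinuousP f).1.
  rewrite (_ : [set x | _] = set0); first exact: open0.
  by apply/seteqP; split=> x //=; rewrite ltNge leey.
- by move=> y /below[x Ax lt]; exists x.
have [z0 z0D _] := cov _ Ax0.
have [z _ zmin] := @arg_minP _ _ D [` z0D]%fset xpredT (fun z => f (val z)) isT.
have [y yD /= lt] := cov (val z) (set_mem (DA _ (valP z))).
by have := zmin [` yD]%fset isT; rewrite leNgt lt.
Qed.

(** * The proximal step at a solution of the variational inequality *)

Section Prox.
Context {R : realType} {d : nat}.
Variables (F : 'rV[R]_d -> 'rV[R]_d) (r : 'rV[R]_d -> \bar R).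
Hypotheses (r_proper : eproper r) (r_lsc : lower_semicontinuous r).
Hypothesis r_convex : econvex r.
Variables (xs : 'rV[R]_d) (gamma : R).
Hypotheses (xs_sol : VI_sol F r xs) (gamma_gt0 : 0 < gamma).

(** At a point [x] of the domain of [r], the value [r xs = +oo] would turn the left side of the
    inequality into [-oo]. *)
Lemma VI_sol_fin_num : r xs \is a fin_num.
Proof.
have [r_ninfty [x rx]] := r_proper.
have := xs_sol x; have := r_ninfty xs; have := r_ninfty x.
by move: rx; case: (r xs) => [a||]; case: (r x) => [b||].
Qed.

Let rx := fine (r xs).

Lemma VI_sol_minorant y (b : R) :
  (r y <= b%:E)%E -> rx - dot (F xs) (y - xs) <= b.
Proof.
have [r_ninfty _] := r_proper.
have := xs_sol y; have := r_ninfty y; rewrite /rx.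
have := VI_sol_fin_num; case: (r xs) => [a _|//|//] /=.
case: (r y) => [c _|//|//].
by rewrite -EFinB -EFinD !lee_fin => h1 h2; lra.
Qed.

Let phi z y := (r y + (enorm (y - z)%R ^+ 2 / (2 * gamma))%:E)%E.

Lemma prox_objective_lsc z : lower_semicontinuous (phi z).
Proof.
move=> x a; rewrite /phi => lt.
set c := fun y => enorm (y - z) ^+ 2 / (2 * gamma).
have c_cvg : c y @[y --> x] --> c x.
  rewrite /c; under eq_cvg do rewrite enorm_sqr.
  rewrite enorm_sqr.
  exact: (cvgM (@dot_sqr_continuous _ _ z x) (cvg_cst _)).
(* The number [b] splits [a < r x + c x] into [b < r x] and [a - b < c x]: two conditions that
   persist near [x], by semicontinuity and continuity. *)
have [b [ab rb]] : exists b, a - c x < b /\ (b%:E < r x)%E.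
  have [r_ninfty _] := r_proper.
  move: lt (r_ninfty x); rewrite -/(c x); case: (r x) => [s|_ _|//].
    rewrite -EFinD lte_fin => lt _; exists ((a - c x + s) / 2).
    by rewrite lte_fin; split; lra.
  by exists (a - c x + 1); split; [lra|rewrite ltry].
have [V Vx rV] := r_lsc rb.
exists (V `&` [set y | a - b < c y]).
  apply: filterI => //.
  by apply: (cvgr_gt _ c_cvg); lra.
move=> y [/rV ry cy]; have : ((b + c y)%:E <= r y + (c y)%:E)%E.
  by rewrite EFinD leeD2r// ltW.
by apply: lt_le_trans; rewrite lte_fin; move: cy => /=; lra.
Qed.

(* The affine minorant of [r] given by the variational inequality at [xs]
   confines the sublevel set of the objective at [xs] to a ball centred at
   [z + gamma *: F xs], so the minimum may be sought on a compact box. *)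
Lemma prox_argmins_nonempty z : argmins setT (phi z) !=set0.
Proof.
set c := z + gamma *: F xs.
(* The summand 1 avoids a square root: [2 * |e| <= e ^+ 2 + 1 <= M]. *)
set M := 1 + dot (xs - c) (xs - c).
set A := [set y : 'rV[R]_d | forall i, `[c 0 i - M, c 0 i + M]%classic (y 0 i)].
have box y : dot (y - c) (y - c) <= dot (xs - c) (xs - c) -> A y.
  move=> le i; have := sqr_coord_le_dot (y - c) i; rewrite !mxE.
  set e := y 0 i + _ => le2.
  have {}le2 : e ^+ 2 <= M - 1 by rewrite /M; lra.
  have : (e + 1) ^+ 2 >= 0 by exact: sqr_ge0.
  have : (e - 1) ^+ 2 >= 0 by exact: sqr_ge0.
  rewrite /= in_itv/= => h1 h2.
  have M0 : M >= 1 by rewrite /M lerDl dot_ge0.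
  apply/andP; split; rewrite /e in le2 h1 h2; nra.
have cA : compact A.
  apply: (@rV_compact _ _ (fun i => `[c 0 i - M, c 0 i + M]%classic)) => i.
  exact: segment_compact.
have [|y Ay ymin] := lsc_compact_min (@prox_objective_lsc z) _ cA
  (ex_intro _ xs (box _ (lexx _))).
- have [r_ninfty _] := r_proper.
  move=> y; rewrite /phi; have := r_ninfty y; case: (r y) => // a _.
  by rewrite -EFinD ltNyr.
exists y; split=> // x _.
have [le|lt] := leP (dot (x - c) (x - c)) (dot (xs - c) (xs - c)).
  exact/ymin/box.
apply: le_trans (ymin _ (box _ (lexx _))) _; rewrite /phi.
have [rxx|] := boolP (r x \is a fin_num); last first.
  have [r_ninfty _] := r_proper; have := r_ninfty x.
  by case: (r x) => //= _ _; rewrite addye// leey.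
have := @VI_sol_minorant x (fine (r x)); rewrite fineK// lexx => /(_ isT) h.
rewrite -(fineK VI_sol_fin_num) -(fineK rxx) -!EFinD lee_fin.
(* Times [2 * gamma], the gap between the objectives at [x] and [xs] is, by the minorant and
   completion of the square, at least the difference of their squared distances to [c]. *)
rewrite -/rx !enorm_sqr -subr_ge0.
rewrite [X in 0 <= X](_ : _ = (2 * gamma * (fine (r x) - rx) +
   dot (x - z) (x - z) - dot (xs - z) (xs - z)) / (2 * gamma)); last first.
  by field; rewrite gt_eqF.
apply: divr_ge0; last by rewrite mulr_ge0// ltW.
have : 2 * gamma * (fine (r x) - rx) >= 2 * gamma * - dot (F xs) (x - xs).
  apply: ler_wpM2l; first by rewrite mulr_ge0// ltW.
  lra.
move: lt; rewrite /c !dotE ?(dotC z x) ?(dotC z xs) ?(dotC (F xs) z)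
  ?(dotC (F xs) x) ?(dotC (F xs) xs); lra.
Qed.

Lemma prox_minimal z y : (phi z (prox gamma r z) <= phi z y)%E.
Proof.
have [y0 y0min] := prox_argmins_nonempty z.
have [_ min] : argmins setT (phi z) (prox gamma r z) by exact: (xgetI 0 y0min).
exact: min.
Qed.

Lemma prox_fin_num z : r (prox gamma r z) \is a fin_num.
Proof.
have [r_ninfty _] := r_proper.
have := prox_minimal z xs; have := r_ninfty (prox gamma r z).
rewrite /phi -(fineK VI_sol_fin_num) -EFinD.
by case: (r (prox _ _ _)).
Qed.

(* Minimality of the proximal point is tested on the segment towards [xs]. *)
Lemma prox_VI_sol_dot z :
  dot (prox gamma r z - xs) (prox gamma r z - xs) <=
  dot (z + gamma *: F xs - xs) (prox gamma r z - xs).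
Proof.
set y := prox gamma r z.
set ry := fine (r y).
have ryE : r y = ry%:E by rewrite fineK// prox_fin_num.
have rxE : r xs = rx%:E by rewrite fineK// VI_sol_fin_num.
have minor : rx - dot (F xs) (y - xs) <= ry.
  by apply: VI_sol_minorant; rewrite ryE.
(* At parameter [t] on the segment, minimality, convexity and the minorant at [y] give
   [0 <= t * (p + t * q)]. *)
set p := 2 * dot (z + gamma *: F xs - y) (y - xs).
set q := dot (y - xs) (y - xs).
have q0 : 0 <= q by exact: dot_ge0.
have seg t : 0 < t <= 1 -> 0 <= p + t * q.
  move=> /andP[t0 t1].
  have conv : (r (t *: xs + (1 - t) *: y) <= (t * rx + (1 - t) * ry)%:E)%E.
    rewrite EFinD !EFinM -rxE -ryE; apply: r_convex.
    by rewrite ltW.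
  have := prox_minimal z (t *: xs + (1 - t) *: y); rewrite -/y /phi ryE => le.
  have {le}le := le_trans le (leeD2r _ conv).
  move: le; rewrite -!EFinD lee_fin !enorm_sqr => le.
  have {}le : 2 * gamma * ry + dot (y - z) (y - z) <=
      2 * gamma * (t * rx + (1 - t) * ry) +
      dot (t *: xs + (1 - t) *: y - z) (t *: xs + (1 - t) *: y - z).
    have g2 : 0 < 2 * gamma by rewrite mulr_gt0.
    have := ler_wpM2l (ltW g2) le; rewrite !mulrDr.
    by rewrite !(mulrCA (2 * gamma) (dot _ _)) mulfV ?gt_eqF// !mulr1.
  have tm : gamma * t * (rx - dot (F xs) (y - xs)) <= gamma * t * ry.
    by apply: ler_wpM2l => //; rewrite mulr_ge0// ltW.
  rewrite -(pmulr_rge0 _ t0) /p /q; move: le tm.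
  by rewrite !dotE ?(dotC xs y) ?(dotC z y) ?(dotC z xs)
    ?(dotC (F xs) y) ?(dotC (F xs) xs); lra.
have p0 : 0 <= p.
  rewrite leNgt; apply/negP => p0.
  have qp : 0 < q - p by lra.
  (* An explicit [t] replaces the limit at 0: here [p + t * q = - p ^+ 2 / (q - p)], which is
     negative. *)
  have := seg (- p / (q - p)).
  rewrite ler_pdivrMr// mul1r divr_gt0 ?oppr_gt0//= => /(_ _)/wrap[]; first lra.
  rewrite [X in 0 <= X](_ : _ = - (p ^+ 2 / (q - p))); last first.
    by field; rewrite gt_eqF.
  rewrite oppr_ge0 => h.
  have : 0 < p ^+ 2 / (q - p) by rewrite divr_gt0// exprn_even_gt0// (lt_eqF p0).
  by rewrite ltNge h.
by move: p0; rewrite /p /q !dotE ?(dotC xs y); lra.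
Qed.

(** From [dot a a <= dot b a], the bound [dot a a <= dot b b] follows by expanding
    [0 <= dot (b - a) (b - a)]. *)
Lemma prox_VI_sol_contract z :
  dot (prox gamma r z - xs) (prox gamma r z - xs) <=
  dot (z + gamma *: F xs - xs) (z + gamma *: F xs - xs).
Proof.
have := prox_VI_sol_dot z.
move: (prox gamma r z - xs) (z + gamma *: F xs - xs) => a b le.
have : 0 <= dot (b - a) (b - a) by exact: dot_ge0.
by rewrite !dotE (dotC a b); lra.
Qed.

End Prox.

(** * Averages over tuples of draws *)

Lemma big_tupleS (V : nmodType) (I : finType) k (f : seq I -> V) :
  \sum_(s : k.+1.-tuple I) f s =
  \sum_(i : I) \sum_(s : k.-tuple I) f (i :: s).
Proof.
rewrite pair_big /=.
rewrite (reindex (fun p : I * k.-tuple I => [tuple of p.1 :: p.2])) //=.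
exists (fun s => (thead s, [tuple of behead s])) => [[i s] _|s _] /=.
  by rewrite theadE; congr pair; apply: val_inj.
by rewrite -tuple_eta.
Qed.

(** The induction splits off the first draw: the remaining ones are averaged from each successor
    state, hence the quantification over [s]. Here [c] is the weight of one draw. *)
Lemma sum_foldl_contract (R : realType) (S : Type) (I : finType)
    (step : S -> I -> S) (V : S -> R) (c rho : R) :
  0 <= c -> 0 <= rho ->
  (forall s, c * \sum_(i : I) V (step s i) <= rho * V s) ->
  forall k s, c ^+ k * \sum_(t : k.-tuple I) V (foldl step s t) <=
              rho ^+ k * V s.
Proof.
move=> c0 rho0 stepV; elim=> [|k IHk] s.
  rewrite !expr0 !mul1r (eq_bigr (fun=> V s)) => [|t _]; last by rewrite tuple0.
  by rewrite sumr_const card_tuple expn0.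
rewrite (big_tupleS _ (fun t => V (foldl step s t))) /= exprS -mulrA mulr_sumr.
apply: (@le_trans _ _ (c * \sum_i rho ^+ k * V (step s i))).
  by apply: ler_wpM2l => //; apply: ler_sum => i _; exact: IHk.
rewrite -mulr_sumr mulrCA exprSr -mulrA; apply: ler_wpM2l => //.
exact: exprn_ge0.
Qed.

(** * The law of the first [k] draws *)

Section Sampling.
Context {disp : measure_display} {T : measurableType disp} {R : realType}.
Context (P : probability T R) {n : nat}.
Variable j : nat -> T -> 'I_n.
Hypothesis j_iid : iid_uniform P j.

Let draws k t := mkseq (j^~ t) k.

(** This is the form to which independence applies. In [nth a s i = a] the point [a] is its own
    default, so an empty tuple causes no trouble. *)
Lemma prefix_eventE k (s : k.-tuple 'I_n) :
  [set t | draws k t = s] =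
  \bigcap_(i in [set` iota 0 k])
    (j i @^-1` [set a | nth a s i = a]).
Proof.
apply/seteqP; split=> t /=.
  move=> ts i /=; rewrite mem_iota add0n => ik.
  by rewrite -ts nth_mkseq.
move=> h; have sz : size (draws k t) = size s by rewrite size_mkseq size_tuple.
case: k s h sz => [|k] s h sz; first by rewrite (tuple0 s).
apply: (@eq_from_nth _ (thead s)) => // i; rewrite size_mkseq => ik.
rewrite nth_mkseq// -(h i); last by change (i \in iota 0 k.+1); rewrite mem_iota.
by apply: set_nth_default; rewrite size_tuple.
Qed.

Lemma prefix_event_measurable k (s : k.-tuple 'I_n) :
  measurable [set t | draws k t = s].
Proof.
have [j_meas _ _] := j_iid.
by rewrite prefix_eventE; apply: fin_bigcap_measurable => // i _; exact: j_meas.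
Qed.

Lemma prob_prefix_event k (s : k.-tuple 'I_n) :
  P [set t | draws k t = s] = (n%:R^-1 ^+ k)%:E.
Proof.
have [_ unif indep] := j_iid.
rewrite prefix_eventE.
rewrite (indep _ (fun i => [set a | nth a s i = a]))//; last exact: iota_uniq.
rewrite big_seq (eq_bigr (fun=> (n%:R^-1)%:E)) => [|i]; last first.
  rewrite mem_iota add0n /= => ik.
  (* An index below [k] forces [k] to be positive, so the head of [s] supplies a default. *)
  have [a0 _] : exists a : 'I_n, True.
    by case: k s ik => // k s _; exists (thead s).
  rewrite -(unif i (nth a0 s i)); congr (P (j i @^-1` _)).
  apply/seteqP; split=> a /=.
    by move=> <-; apply: set_nth_default; rewrite size_tuple.
  by move=> ->; apply: set_nth_default; rewrite size_tuple.
rewrite -big_seq prodEFin big_const_seq count_predT size_iota.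
by rewrite iter_mulr_1.
Qed.

(** The integrand is a finite sum of indicators of prefix events, exactly one of which contains a
    given [t]. *)
Lemma expectation_prefix k (f : seq 'I_n -> R) :
  (forall s, 0 <= f s) ->
  ('E_P[fun t => f (draws k t)] =
  (n%:R^-1 ^+ k * \sum_(s : k.-tuple 'I_n) f s)%:E)%E.
Proof.
move=> f0; rewrite unlock.
pose E (s : k.-tuple 'I_n) := [set t | draws k t = s].
have mE s : measurable (E s) by exact: prefix_event_measurable.
rewrite (eq_integral (fun t => \sum_(s : k.-tuple 'I_n)
    ((f s)%:E * (\1_(E s) t)%:E)%E)%E); last first.
  move=> t _.
  pose s0 : k.-tuple 'I_n := [tuple of draws k t].
  rewrite (bigD1 s0)//= big1 => [|s ss0].
    by rewrite adde0 indicE mem_set// mule1.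
  rewrite indicE memNset ?mule0// => /= ts.
  by case/eqP: ss0; apply: val_inj.
rewrite ge0_integral_sum//.
- rewrite (eq_bigr (fun s : k.-tuple 'I_n => (f s * n%:R^-1 ^+ k)%:E)).
    by rewrite sumEFin -mulr_suml mulrC.
  move=> s _; rewrite ge0_integralZl_EFin//; last first.
    by apply/measurable_EFinP; exact: measurable_indic.
  rewrite integral_indic// setIT EFinM; congr (_ * _)%E.
  exact: prob_prefix_event.
- move=> s; apply: measurable_funeM.
  by apply/measurable_EFinP; exact: measurable_indic.
- by move=> s t _; rewrite mule_ge0// lee_fin.
Qed.

End Sampling.

Lemma eproj1 (R : realType) (d : nat) (xs x : 'rV[R]_d) :
  eproj [set xs] x = xs.
Proof.
rewrite /eproj /argmin.
suff h : argmins [set xs] (fun y => (enorm (y - x))%:E) xs.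
  by have [-> _] := xgetI 0 h.
by split=> // z ->.
Qed.

(** * One step of SAGA-SGDA *)

Section Saga.
Context {R : realType} {d n : nat}.
Variables (Fs : 'I_n -> 'rV[R]_d -> 'rV[R]_d) (r : 'rV[R]_d -> \bar R).
Variables (xs : 'rV[R]_d) (gamma : R).

Lemma saga_foldl (x0 : 'rV[R]_d) (j : nat -> 'I_n) k :
  saga Fs gamma r x0 j k =
  foldl (saga_step Fs gamma r) (saga_init x0) (mkseq j k).
Proof. by elim: k => [//|k IHk]; rewrite mkseqS foldl_rcons -IHk. Qed.

Definition lyapunov (s : saga_state) : R :=
  enorm (s.1 - xs) ^+ 2 + 4 * n%:R * gamma ^+ 2 * sigma2 Fs s.2 xs.

Lemma sigma2_ge0 w : 0 <= sigma2 Fs w xs.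
Proof.
by rewrite mulr_ge0 ?invr_ge0// sumr_ge0// => i _; rewrite sqr_ge0.
Qed.

Lemma lyapunov_ge s : enorm (s.1 - xs) ^+ 2 <= lyapunov s.
Proof.
by rewrite lerDl mulr_ge0 ?sigma2_ge0// mulr_ge0 ?sqr_ge0// mulr_ge0.
Qed.

(** Table entry [l] is refreshed by the draw [l] alone and kept by the other [n - 1]. *)
Lemma sum_sigma2_step (s : saga_state) :
  (0 < n)%N ->
  \sum_(i < n) sigma2 Fs (saga_step Fs gamma r s i).2 xs =
  (n%:R - 1) * sigma2 Fs s.2 xs + sigma2 Fs (fun=> s.1) xs.
Proof.
move=> n0; have nR : n%:R != 0 :> R by rewrite pnatr_eq0 -lt0n.
rewrite /sigma2 /= -mulr_sumr exchange_big /=.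
rewrite (eq_bigr (fun l => (n%:R - 1) * enorm (Fs l (s.2 l) - Fs l xs) ^+ 2
    + enorm (Fs l s.1 - Fs l xs) ^+ 2)).
  by rewrite big_split /= -mulr_sumr mulrDr mulrCA.
move=> l _; rewrite (bigD1 l)//= eqxx addrC; congr (_ + _).
rewrite (eq_bigr (fun=> enorm (Fs l (s.2 l) - Fs l xs) ^+ 2)).
  rewrite sumr_const -[LHS]mulr_natl; congr (_ * _).
  rewrite cardC1 card_ord -subn1 natrB//.
by move=> i il; rewrite eq_sym (negbTE il).
Qed.

(* With [A_i = F_i x - F_i x^*] and [B_i = F_i w_i - F_i x^*], the direction
   satisfies [g_i - F x^* = A_i - (B_i - mean B)]; its second moment is bounded
   by twice those of [A_i] and of [B_i - mean B], and the latter is a variance,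
   hence at most the second moment of [B_i]. *)
Lemma saga_dir_sqr_sum (s : saga_state) : (0 < n)%N ->
  \sum_(i < n) dot (saga_dir Fs s i - mean_op Fs xs)
                   (saga_dir Fs s i - mean_op Fs xs) <=
  n%:R * (2 * sigma2 Fs (fun=> s.1) xs + 2 * sigma2 Fs s.2 xs).
Proof.
move=> n0; have nR : n%:R != 0 :> R by rewrite pnatr_eq0 -lt0n.
rewrite mulrDr !(mulrCA n%:R 2) /sigma2 !mulVKf//.
pose A i := Fs i s.1 - Fs i xs.
pose B i := Fs i (s.2 i) - Fs i xs.
pose m := n%:R^-1 *: \sum_(i < n) B i.
have dirE i : saga_dir Fs s i - mean_op Fs xs = A i - (B i - m).
  rewrite /saga_dir /mean_op /A /B /m sumrB scalerBr.
  rewrite !opprB -!addrA; congr (_ + _); rewrite !addrA.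
  by rewrite -[in RHS]addrA [RHS]addrC !addrA; apply/rowP => l; rewrite !mxE; ring.
(* The last bracket sums to [- 2 * n%:R * dot m m], since the [B i] add up to [n%:R *: m]; this is
   the variance bound. *)
apply: (@le_trans _ _ (\sum_(i < n) (2 * enorm (A i) ^+ 2
    + 2 * enorm (B i) ^+ 2 + (2 * dot m m - 4 * dot (B i) m)))).
  apply: ler_sum => i _; rewrite dirE !enorm_sqr.
  move: (A i) (B i) (m) => a b c; have := dot_ge0 (a + (b - c)).
  by rewrite !dotE (dotC b a) (dotC c a) (dotC c b); lra.
rewrite !big_split /= -!mulr_sumr gerDl sumrN -mulr_sumr -!dot_suml.
rewrite sumr_const card_ord -[m *+ n]scaler_nat.
have -> : \sum_(i < n) B i = n%:R *: m by rewrite scalerA mulfV// scale1r.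
rewrite dotZl.
have := mulr_ge0 (ler0n R n) (dot_ge0 m); lra.
Qed.

(** The direction is unbiased: the table terms cancel in the sum over draws. *)
Lemma saga_dir_sum (s : saga_state) : (0 < n)%N ->
  \sum_(i < n) (saga_dir Fs s i - mean_op Fs xs) =
  n%:R *: (mean_op Fs s.1 - mean_op Fs xs).
Proof.
move=> n0; have nR : n%:R != 0 :> R by rewrite pnatr_eq0 -lt0n.
rewrite sumrB sumr_const card_ord scalerBr !scaler_nat; congr (_ - _).
rewrite /saga_dir /mean_op big_split sumrB /= sumr_const card_ord.
have cancel (v : 'rV[R]_d) : (n%:R^-1 *: v) *+ n = v.
  by rewrite -scaler_nat scalerA mulfV// scale1r.
by rewrite !cancel subrK.
Qed.

Hypothesis n_gt0 : (0 < n)%N.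
Hypotheses (r_proper : eproper r) (r_lsc : lower_semicontinuous r).
Hypothesis r_convex : econvex r.
Hypotheses (xs_sol : VI_sol (mean_op Fs) r xs) (gamma_gt0 : 0 < gamma).
Variables (mu ell : R).
Hypothesis ell_gt0 : 0 < ell.
Hypothesis gamma_le : gamma <= 1 / (6 * ell).
Hypothesis F_qsm : forall x,
  mu * enorm (x - xs) ^+ 2 <= dot (mean_op Fs x - mean_op Fs xs) (x - xs).
Hypothesis F_cocoercive : forall x,
  sigma2 Fs (fun=> x) xs <=
  ell * dot (mean_op Fs x - mean_op Fs xs) (x - xs).

Lemma lyapunov_step s :
  n%:R^-1 * \sum_(i < n) lyapunov (saga_step Fs gamma r s i) <=
  (1 - Num.min (gamma * mu) (1 / (2 * n%:R))) * lyapunov s.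
Proof.
have nR : 0 < n%:R :> R by rewrite ltr0n.
set D := dot (mean_op Fs s.1 - mean_op Fs xs) (s.1 - xs).
set e := enorm (s.1 - xs) ^+ 2.
set sx := sigma2 Fs (fun=> s.1) xs.
set sw := sigma2 Fs s.2 xs.
have prox_sum : \sum_(i < n) enorm ((saga_step Fs gamma r s i).1 - xs) ^+ 2 <=
    n%:R * (e - 2 * gamma * D + gamma ^+ 2 * (2 * sx + 2 * sw)).
  apply: (@le_trans _ _ (\sum_(i < n) (e
      + (- (2 * gamma)) * dot (saga_dir Fs s i - mean_op Fs xs) (s.1 - xs)
      + gamma ^+ 2 * dot (saga_dir Fs s i - mean_op Fs xs)
                         (saga_dir Fs s i - mean_op Fs xs)))).
    apply: ler_sum => i _; rewrite enorm_sqr /=.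
    apply: le_trans
      (prox_VI_sol_contract r_proper r_lsc r_convex xs_sol gamma_gt0 _) _.
    set G := saga_dir Fs s i - mean_op Fs xs.
    have -> : s.1 - gamma *: saga_dir Fs s i + gamma *: mean_op Fs xs - xs =
              (s.1 - xs) - gamma *: G.
      by apply/rowP => l; rewrite !mxE; ring.
    rewrite /e enorm_sqr; move: (s.1 - xs) (G) => u v.
    by rewrite !dotE (dotC u v); lra.
  rewrite !big_split /= sumr_const card_ord -!mulr_sumr -dot_suml.
  rewrite saga_dir_sum// dotZl -/D -mulr_natl.
  have := ler_wpM2l (sqr_ge0 gamma) (saga_dir_sqr_sum s n_gt0).
  rewrite -/sx -/sw; lra.
have muD : mu * e <= D := F_qsm s.1.
have sxD : sx <= ell * D := F_cocoercive s.1.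
have sw0 : 0 <= sw by exact: sigma2_ge0.
have e0 : 0 <= e by exact: sqr_ge0.
have D0 : 0 <= D.
  rewrite -(pmulr_rge0 _ ell_gt0); apply: le_trans sxD; exact: sigma2_ge0.
have gl : 6 * (gamma * ell) <= 1.
  by move: gamma_le; rewrite ler_pdivlMr; [lra|rewrite mulr_gt0].
rewrite mulrC ler_pdivrMr// /lyapunov big_split /= -mulr_sumr sum_sigma2_step//.
rewrite -/e -/sx -/sw.
set q := Num.min _ _.
have qmu : q <= gamma * mu by rewrite ge_min lexx.
have qn : q * n%:R * 2 <= 1.
  have : q <= 1 / (2 * n%:R) by rewrite ge_min lexx orbT.
  by rewrite ler_pdivlMr ?mulr_gt0//; lra.
(* Up to a common factor [n], [gamma ^+ 2 * sx] occurs 2 times from the prox step and 4 times from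
   the refreshed table, so 1/6 of [gamma * D] each uses half of the decrease [2 * gamma * D]; the
   other half pays for [q * e]. The table loses 4 and regains 2 times [gamma ^+ 2 * sw], and the net
   loss covers [q] times its weight [4 * n]. *)
have gD : gamma ^+ 2 * sx <= gamma * D / 6.
  apply: (@le_trans _ _ (gamma ^+ 2 * (ell * D))).
    by rewrite ler_wpM2l// sqr_ge0.
  have := ler_wpM2r (mulr_ge0 (ltW gamma_gt0) D0) gl; lra.
have qe : q * e <= gamma * D.
  apply: (@le_trans _ _ (gamma * mu * e)); first exact: ler_wpM2r.
  by rewrite -mulrA ler_wpM2l// ltW.
have qs : q * n%:R * 2 * (gamma ^+ 2 * sw) <= 1 * (gamma ^+ 2 * sw).
  by apply: ler_wpM2r => //; rewrite mulr_ge0// sqr_ge0.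
have N1 := ler_wpM2l (ltW nR) gD.
have N2 := ler_wpM2l (ltW nR) qe.
have N3 := ler_wpM2l (ltW nR) qs.
move: prox_sum; lra.
Qed.

End Saga.

Theorem theoremF13 (R : realType) (d n : nat) (hn : (0 < n)%N)
    (Fs : 'I_n -> 'rV[R]_d -> 'rV[R]_d) (r : 'rV[R]_d -> \bar R)
    (r_proper : eproper r) (r_lsc : lower_semicontinuous r)
    (r_convex : econvex r)
    (mu : R) (mu_gt0 : 0 < mu)
    (F_qsm : quasi_strongly_monotone (mean_op Fs) r mu)
    (ell : R) (ell_gt0 : 0 < ell)
    (F_cocoercive : forall x : 'rV[R]_d,
       let xs := eproj (VI_sol (mean_op Fs) r) x in
       n%:R^-1 * (\sum_(i < n) enorm (Fs i x - Fs i xs) ^+ 2)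
       <= ell * dot (mean_op Fs x - mean_op Fs xs) (x - xs))
    (xs : 'rV[R]_d) (sol_xs : VI_sol (mean_op Fs) r = [set xs])
    (gamma : R) (gamma_gt0 : 0 < gamma) (gamma_le : gamma <= 1 / (6 * ell))
    (disp : measure_display) (T : measurableType disp) (P : probability T R)
    (j : nat -> T -> 'I_n) (j_iid : iid_uniform P j)
    (x0 : 'rV[R]_d) (k : nat) :
  let x (m : nat) (t : T) : 'rV[R]_d :=
    (saga Fs gamma r x0 (fun i => j i t) m).1 in
  let V0 : R := enorm (x0 - xs) ^+ 2
    + 4 * n%:R * gamma ^+ 2 * sigma2 Fs (saga_init x0).2 xs in
  ('E_P[fun t => (enorm (x k t - xs) ^+ 2)%R]
   <= ((1 - Num.min (gamma * mu) (1 / (2 * n%:R))) ^+ k * V0)%:E)%E.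
Proof.
cbv zeta.
have xs_sol : VI_sol (mean_op Fs) r xs by rewrite sol_xs.
have qsm y : mu * enorm (y - xs) ^+ 2 <=
    dot (mean_op Fs y - mean_op Fs xs) (y - xs).
  by have := F_qsm y; rewrite sol_xs /= eproj1.
have coc y : sigma2 Fs (fun=> y) xs <=
    ell * dot (mean_op Fs y - mean_op Fs xs) (y - xs).
  by have := F_cocoercive y; rewrite sol_xs /= eproj1.
pose run := foldl (saga_step Fs gamma r) (saga_init x0).
rewrite (_ : (fun t => _) =
    fun t => enorm ((run (mkseq (j^~ t) k)).1 - xs) ^+ 2); last first.
  by apply/funext => t; rewrite saga_foldl.
rewrite (expectation_prefix j_iid _ (f := fun s => enorm ((run s).1 - xs) ^+ 2)).
  have n_inv : 0 <= n%:R^-1 :> R by rewrite invr_ge0.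
  (* The bound [1 / (2 * n%:R) <= 1] suffices, whatever the size of [gamma * mu]. *)
  have rho_ge0 : 0 <= 1 - Num.min (gamma * mu) (1 / (2 * n%:R)).
    rewrite subr_ge0 ge_min; apply/orP; right.
    rewrite ler_pdivrMr ?mulr_gt0 ?ltr0n// mul1r -natrM ler1n.
    by rewrite muln_gt0.
  have step := lyapunov_step hn r_proper r_lsc r_convex xs_sol gamma_gt0
    ell_gt0 gamma_le qsm coc.
  rewrite lee_fin.
  (* [V0] is by conversion the value of [lyapunov] at the initial state. *)
  apply: le_trans (sum_foldl_contract n_inv rho_ge0 step k (saga_init x0)).
  apply: ler_wpM2l; first exact: exprn_ge0.
  by apply: ler_sum => s _; exact: lyapunov_ge.
by move=> s; exact: sqr_ge0.
Qed.
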